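(* Let $n\ge2$ and let $A$ be an $n\times n$ irreducible completely positive matrix whose graph $G(A)$ is triangle free. Then the following are equivalent: (a) the comparison matrix $M(A)$ is singular; (b) $A$ has a unique CP factorization; (c) $A$ has a unique minimal CP factorization.
   Context: A symmetric $n\times n$ matrix $A$ is completely positive if $A=BB^T$ for some entrywise nonnegative $n\times k$ matrix $B$; such an equality is a CP factorization of $A$. Only CP factorizations in which the columns of $B$ are pairwise linearly independent are considered, and two CP factorizations $A=BB^T=CC^T$ are considered equal if $C=BP$ for a permutation matrix $P$. The cp-rank of $A$ is the minimal number of columns of such a nonnegative $B$; a CP factorization with that many columns is called minimal. The graph $G(A)$ of a symmetric $n\times n$ matrix $A$ has vertex set $\{1,\dots,n\}$, with $\{i,j\}$ ($i\ne j$) an edge iff $a_{ij}\ne 0$; $A$ is irreducible iff $G(A)$ is connected. A graph is triangle free if it contains no clique on three vertices. The comparison matrix $M(A)$ of a square matrix $A$ is given by $M(A)_{ii}=|a_{ii}|$ and $M(A)_{ij}=-|a_{ij}|$ for $i\ne j$. *)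

(* Defs.v *)
From HB Require Import structures.
From mathcomp Require Import all_boot all_order all_algebra all_fingroup.
From mathcomp Require Import reals.
Set Implicit Arguments. Unset Strict Implicit. Unset Printing Implicit Defensive.
Import Order.TTheory GRing.Theory Num.Theory.
Local Open Scope ring_scope.

Section Defs.
Variable R : realType.

Definition nonneg_mx m k (B : 'M[R]_(m, k)) : Prop := forall i j, 0 <= B i j.

Definition symmetric_mx n (A : 'M[R]_n) : Prop := A^T = A.

Definition nonneg_fact n k (A : 'M[R]_n) (B : 'M[R]_(n, k)) : Prop :=
  nonneg_mx B /\ A = B *m B^T.

Definition completely_positive n (A : 'M[R]_n) : Prop :=
  exists k (B : 'M[R]_(n, k)), nonneg_fact A B.

Definition pairwise_indep_cols n k (B : 'M[R]_(n, k)) : Prop :=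
  forall i j : 'I_k, i != j ->
    forall a b : R, a *: col i B + b *: col j B = 0 -> a = 0 /\ b = 0.

Definition cp_fact n k (A : 'M[R]_n) (B : 'M[R]_(n, k)) : Prop :=
  nonneg_fact A B /\ pairwise_indep_cols B.

(* C = B P for a permutation matrix P, i.e. C's columns are a permutation of B's *)
Definition cp_fact_eq n k k' (B : 'M[R]_(n, k)) (C : 'M[R]_(n, k')) : Prop :=
  exists e : 'I_k' -> 'I_k, bijective e /\ forall i j, C i j = B i (e j).

Definition is_cp_rank n (A : 'M[R]_n) (r : nat) : Prop :=
  (exists B : 'M[R]_(n, r), nonneg_fact A B) /\
  (forall k (B : 'M[R]_(n, k)), nonneg_fact A B -> (r <= k)%N).

Definition minimal_cp_fact n k (A : 'M[R]_n) (B : 'M[R]_(n, k)) : Prop :=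
  cp_fact A B /\ is_cp_rank A k.

Definition unique_cp_fact n (A : 'M[R]_n) : Prop :=
  exists k (B : 'M[R]_(n, k)), cp_fact A B /\
    forall k' (C : 'M[R]_(n, k')), cp_fact A C -> cp_fact_eq B C.

Definition unique_minimal_cp_fact n (A : 'M[R]_n) : Prop :=
  exists k (B : 'M[R]_(n, k)), minimal_cp_fact A B /\
    forall k' (C : 'M[R]_(n, k')), minimal_cp_fact A C -> cp_fact_eq B C.

Definition graph_rel n (A : 'M[R]_n) : rel 'I_n :=
  fun i j => (i != j) && (A i j != 0).

(* A irreducible iff G(A) connected *)
Definition irreducible_mx n (A : 'M[R]_n) : Prop :=
  forall i j : 'I_n, connect (graph_rel A) i j.

Definition triangle_free_graph n (A : 'M[R]_n) : Prop :=
  ~ exists i j l : 'I_n,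
      [&& graph_rel A i j, graph_rel A j l & graph_rel A i l].

Definition comparison_mx n (A : 'M[R]_n) : 'M[R]_n :=
  \matrix_(i, j) (if i == j then `|A i i| else - `|A i j|).

End Defs.

(* Main.v *)
Require Import Defs.
From HB Require Import structures.
From mathcomp Require Import all_boot all_order all_algebra all_fingroup.
From mathcomp Require Import boolp reals.
From mathcomp Require Import ring zify.
Set Implicit Arguments. Unset Strict Implicit. Unset Printing Implicit Defensive.
Import Order.TTheory GRing.Theory Num.Theory.
Local Open Scope ring_scope.

(** In a nonnegative factorization [A = B B^T] the support of a column is a
    clique, hence has at most two elements, and the quadratic form of [M(A)] at
    [x] is the sum over the columns, supported on [{i, j}], of
    [(B i c * x i - B j c * x j) ^+ 2].

    If [M(A)] is singular, a kernel vector [x] has no zero entry by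
    connectedness; every column of every factorization is then supported on an
    edge with a ratio of entries prescribed by [x], so there is exactly one
    column per edge and it is determined by [A] and [x].

    Conversely, let a minimal factorization be unique. Rotating a pair of columns
    changes the number of nonzero entries if a column is supported on a single
    vertex, or if two columns are supported on the same edge; hence there is
    exactly one column per edge and nothing else. Along a simple cycle of the
    graph on which the product of the ratios of the entries is not 1, the columns
    can be replaced by others with the same supports. So all these products are
    1, the ratios come from a potential on the vertices, and this potential is in
    the kernel of [M(A)]. *)

(** * Periodic solutions of an affine recurrence *)

(* Solved by variation of constants: [P k] solves the homogeneous recurrence. *)
Lemma cyclic_affine_recurrence (R : realFieldType) (m : nat) (a b : nat -> R) :
    (forall k, (k < m)%N -> 0 < a k) -> (forall k, (k < m)%N -> 0 < b k) ->
    \prod_(0 <= k < m) (a k / b k) != 1 ->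
  exists y : nat -> R,
    [/\ y m = y 0%N, forall k, (k < m)%N -> b k * y k.+1 - a k * y k = 1
      & (forall k, (k <= m)%N -> 0 < y k) \/ (forall k, (k <= m)%N -> y k < 0)].
Proof.
move=> a_gt0 b_gt0; set P := fun l => \prod_(0 <= k < l) (a k / b k).
rewrite -/(P m) => Pm_neq1.
pose S := fun l => \sum_(0 <= k < l) (b k * P k.+1)^-1.
have P_gt0 l : (l <= m)%N -> 0 < P l.
  move=> lm; rewrite /P big_nat_cond; apply: prodr_gt0 => k.
  rewrite andbT => /= kl; have km := leq_trans kl lm.
  by rewrite divr_gt0 ?a_gt0 ?b_gt0.
have Sinc l : (l < m)%N -> S l < S l.+1.
  move=> lm; rewrite /S big_nat_recr //= ltrDl invr_gt0.
  by rewrite mulr_gt0 ?b_gt0 ?P_gt0.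
have S0 : S 0%N = 0 by rewrite /S big_geq.
have P0 : P 0%N = 1 by rewrite /P big_geq.
have S_ge0 l : (l <= m)%N -> 0 <= S l.
  elim: l => [|l IH] lm; first by rewrite S0.
  by apply: le_trans (IH (ltnW lm)) (ltW (Sinc _ lm)).
have S_le d l : (l + d <= m)%N -> S l <= S (l + d)%N.
  elim: d => [|d IH]; first by rewrite addn0.
  rewrite addnS => ldm.
  by apply: le_trans (IH (ltnW ldm)) (ltW (Sinc _ ldm)).
have Sm_gt0 : 0 < S m.
  case: (posnP m) => [m0|m_gt0]; first by move: Pm_neq1; rewrite m0 P0 eqxx.
  rewrite -S0 (lt_le_trans (Sinc _ m_gt0)) //.
  by have := S_le m.-1 1%N; rewrite add1n prednK //; apply.
(* The constant of integration forced by [y m = y 0], that is by [P m * (g + S m) = g]. *)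
pose g := P m * S m / (1 - P m).
have Pm1 : 1 - P m != 0 by rewrite subr_eq0 eq_sym.
have gS : g + S m = S m / (1 - P m) by rewrite /g; field.
exists (fun k => P k * (g + S k)); split.
- by rewrite P0 S0 gS /g; field.
- move=> k km; have bk : b k != 0 by rewrite gt_eqF ?b_gt0.
  have ak : a k != 0 by rewrite gt_eqF ?a_gt0.
  have Pk : P k != 0 by rewrite gt_eqF ?P_gt0 // ltnW.
  have -> : S k.+1 = S k + (b k * P k.+1)^-1 by rewrite /S big_nat_recr.
  have -> : P k.+1 = P k * (a k / b k) by rewrite /P big_nat_recr.
  by field; rewrite ak bk Pk.
(* [g + S k] lies between [g] and [g + S m], which both have the sign of [1 - P m]. *)
- case: (ltrgtP (P m) 1) Pm_neq1 => // Pm _; [left|right] => k km.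
    rewrite mulr_gt0 ?P_gt0 // ltr_pwDl ?S_ge0 // /g.
    by rewrite divr_gt0 ?subr_gt0 // mulr_gt0 ?P_gt0.
  rewrite pmulr_rlt0 ?P_gt0 //; apply: (@le_lt_trans _ _ (g + S m)).
    by rewrite lerD2l; have := S_le (m - k)%N k; rewrite subnKC //; apply.
  by rewrite gS pmulr_rlt0 // invr_lt0 subr_lt0.
Qed.

(** * Weights of closed walks and potentials *)

Fixpoint walk_weight (R : comNzRingType) (T : Type) (w : T -> T -> R) (x : T)
    (p : seq T) : R :=
  if p is y :: p' then w x y * walk_weight w y p' else 1.

Lemma walk_weight_cat (R : comNzRingType) (T : Type) (w : T -> T -> R) x p q :
  walk_weight w x (p ++ q) = walk_weight w x p * walk_weight w (last x p) q.
Proof. by elim: p x => [|y p IH] x /=; rewrite ?mul1r // IH mulrA. Qed.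

Lemma walk_weight_nth (R : comNzRingType) (T : Type) (w : T -> T -> R) x0 x p :
  walk_weight w x p =
    \prod_(0 <= i < size p) w (nth x0 (x :: p) i) (nth x0 (x :: p) i.+1).
Proof.
elim: p x => [|y p IH] x /=; first by rewrite big_geq.
by rewrite big_nat_recl //= IH.
Qed.

Lemma nuniq_split (T : eqType) (s : seq T) :
  ~~ uniq s -> exists y s1 s2 s3, s = rcons s1 y ++ rcons s2 y ++ s3.
Proof.
elim: s => //= x s IH; rewrite negb_and negbK => /orP[xs|/IH].
  by case/splitPr: xs => s2 s3; exists x, [::], s2, s3; rewrite !cat_rcons.
by move=> [y [s1 [s2 [s3 ->]]]]; exists y, (x :: s1), s2, s3.
Qed.

(** Induction on the length: at a repeated vertex [y], the block [rcons s2 y] is a shorter closed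
    walk, and cutting it out leaves another one. A closed walk ends at its start, so [uniq p]
    describes a simple cycle, including an edge taken back and forth. *)
Lemma closed_walk_balanced (R : comNzRingType) (T : eqType) (e : rel T)
    (w : T -> T -> R) :
    (forall x p, path e x p -> last x p = x -> uniq p -> walk_weight w x p = 1) ->
  forall x p, path e x p -> last x p = x -> walk_weight w x p = 1.
Proof.
move=> simple x p; have [N] := ubnP (size p); elim: N x p => // N IH x p.
rewrite ltnS => sp ep lp.
case: (boolP (uniq p)) => [|/nuniq_split]; first exact: simple.
move=> [y [s1 [s2 [s3 E]]]]; move: sp ep lp; rewrite {}E.
rewrite !size_cat !size_rcons !cat_path !last_cat !last_rcons.
move=> sp /and3P[e1 e2 e3] lp.
rewrite !walk_weight_cat !last_rcons (IH y (rcons s2 y)) ?last_rcons //; last first.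
  by rewrite size_rcons; apply: leq_trans sp; rewrite addSn ltnS addnCA leq_addr.
rewrite mul1r; have := IH x (rcons s1 y ++ s3).
rewrite walk_weight_cat size_cat size_rcons cat_path last_cat !last_rcons e1 e3 lp.
by apply=> //; apply: leq_trans sp; rewrite ltn_add2l addSn ltnS leq_addl.
Qed.

(** [f j] is the weight of a chosen walk from [r] to [j]. A return walk supplies its inverse, so
    [f j] is nonzero; two closed walks sharing the return from [j] compare [f j] with
    [f i * w i j]. *)
Lemma balanced_potential (R : fieldType) (T : finType) (e : rel T)
    (w : T -> T -> R) (r : T) :
    (forall i j, connect e i j) ->
    (forall x p, path e x p -> last x p = x -> walk_weight w x p = 1) ->
  exists f : T -> R, (forall i, f i != 0) /\
    forall i j, e i j -> f j = f i * w i j.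
Proof.
move=> conn bal.
have /fin_all_exists[P HP] j : exists p, path e r p /\ last r p = j.
  by case/connectP: (conn r j) => p ep ->; exists p.
pose f j := walk_weight w r (P j); exists f.
have ret j : exists2 q, path e j q /\ last j q = r & f j * walk_weight w j q = 1.
  case/connectP: (conn j r) => q eq rq; exists q => //.
  have [ep lp] := HP j; rewrite /f -{2}lp -walk_weight_cat bal //.
    by rewrite cat_path ep lp.
  by rewrite last_cat lp.
split=> [i|i j eij].
  have [q _ fq] := ret i; apply: contra_eq_neq fq => ->.
  by rewrite mul0r eq_sym oner_neq0.
have [q [eq lq] fq] := ret j; have [ep lp] := HP i.
have := bal r (P i ++ j :: q); rewrite cat_path last_cat lp /= ep eij eq lq.
move=> /(_ isT erefl); rewrite walk_weight_cat lp /= mulrA -fq -/(f i).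
have q0 : walk_weight w j q != 0.
  by apply: contra_eq_neq fq => ->; rewrite mulr0 eq_sym oner_neq0.
by move/(mulIf q0).
Qed.

(** * Nonnegative factorizations, plane rotations and minimality *)

Lemma nonneg_factP (R : realType) n k (A : 'M[R]_n) (B : 'M[R]_(n, k)) :
  nonneg_fact A B <->
  nonneg_mx B /\ forall i j, A i j = \sum_c B i c * B j c.
Proof.
have E i j : (B *m B^T) i j = \sum_c B i c * B j c.
  by rewrite mxE; apply: eq_bigr => c _; rewrite mxE.
split=> [[B0 ->]|[B0 AE]]; split=> // ; last apply/matrixP => i j.
by rewrite E AE.
Qed.

(** For [i != j], right multiplication by the plane rotation of cosine [a / r] and sine [b / r],
    which preserves [B *m B^T]. Leaving [a] and [b] unnormalized lets them be read off entries of
    [B]. *)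
Definition rotate_cols (R : realType) n k (B : 'M[R]_(n, k)) (i j : 'I_k)
    (a b : R) : 'M[R]_(n, k) :=
  let r := Num.sqrt (a ^+ 2 + b ^+ 2) in
  \matrix_(v, c) (if c == i then (a * B v i - b * B v j) / r
                  else if c == j then (b * B v i + a * B v j) / r else B v c).

Lemma rotate_cols_fact (R : realType) n k (A : 'M[R]_n) (B : 'M[R]_(n, k)) i j a b :
    i != j -> (a != 0) || (b != 0) -> nonneg_fact A B ->
    (forall v, 0 <= a * B v i - b * B v j) ->
    (forall v, 0 <= b * B v i + a * B v j) ->
  nonneg_fact A (rotate_cols B i j a b).
Proof.
move=> ij ab /nonneg_factP[B0 AE] Hi Hj; apply/nonneg_factP.
have r_gt0 : 0 < a ^+ 2 + b ^+ 2.
  case/orP: ab => x0; [apply: ltr_pwDl|apply: ltr_wpDl]; rewrite ?sqr_ge0 //.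
    by rewrite exprn_even_gt0.
  by rewrite exprn_even_gt0.
split=> [v c|v u].
  by rewrite mxE; do 2?case: ifP => _; rewrite ?divr_ge0 ?sqrtr_ge0.
rewrite AE !(bigD1 i (P := predT)) //= !(bigD1 j (P := [pred c | c != i])) /=;
  rewrite 1?eq_sym //.
rewrite !mxE eqxx [j == i]eq_sym (negbTE ij) eqxx !addrA; congr (_ + _).
  set r := Num.sqrt _.
  have r2 : r ^+ 2 = a ^+ 2 + b ^+ 2 by rewrite sqr_sqrtr // ltW.
  have r0 : r != 0 by rewrite gt_eqF // sqrtr_gt0.
  apply: (@mulIf _ (r ^+ 2)); first by rewrite expf_neq0.
  by rewrite {1}r2; field.
apply: eq_bigr => c /andP[ci cj].
by rewrite !mxE (negbTE ci) (negbTE cj).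
Qed.

Lemma drop_zero_col_fact (R : realType) n k (A : 'M[R]_n) (B : 'M[R]_(n, k.+1)) i :
    (forall v, B v i = 0) -> nonneg_fact A B ->
  nonneg_fact A (colsub (lift i) B).
Proof.
move=> Bi /nonneg_factP[B0 AE]; apply/nonneg_factP; split=> [v c|v u].
  by rewrite mxE.
rewrite AE (bigD1_ord i) //= Bi mul0r add0r.
by apply: eq_bigr => c _; rewrite !mxE.
Qed.

(** Of two dependent columns one can be rotated to zero and dropped, against minimality. *)
Lemma rank_fact_indep (R : realType) n k (A : 'M[R]_n) (B : 'M[R]_(n, k)) :
  is_cp_rank A k -> nonneg_fact A B -> pairwise_indep_cols B.
Proof.
case=> _ min fB i j ij a b E; have [B0 _] := fB.
case: (boolP ((a != 0) || (b != 0))) => [ab|]; last first.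
  by rewrite negb_or !negbK => /andP[/eqP-> /eqP->].
(* Both terms of the relation have equal absolute values, so the rotation by [|a|], [|b|] kills
   column [i] and stays nonnegative. *)
have Ea v : `|a| * B v i - `|b| * B v j = 0.
  move/matrixP/(_ v ord0): E; rewrite !mxE => /eqP; rewrite addr_eq0 => /eqP Ev.
  apply/eqP; rewrite subr_eq0 -{1}(ger0_norm (B0 v i)) -{1}(ger0_norm (B0 v j)).
  by rewrite -!normrM Ev normrN.
have fr : nonneg_fact A (rotate_cols B i j `|a| `|b|).
  apply: rotate_cols_fact => // [|v|v]; first by rewrite !normr_eq0.
    by rewrite Ea.
  by rewrite addr_ge0 ?mulr_ge0.
case: k B min fB i j ij E B0 Ea fr => [|k] B min _ i j _ _ _ Ea fr.
  by case: i {Ea fr}.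
have := min _ _ (drop_zero_col_fact (i := i) _ fr).
rewrite ltnn => H; suff : false by []; apply: H => v.
by rewrite mxE eqxx Ea mul0r.
Qed.

Lemma exists_minimal_cp_fact (R : realType) n (A : 'M[R]_n) :
  completely_positive A -> exists k (B : 'M[R]_(n, k)), minimal_cp_fact A B.
Proof.
move=> [k [B fB]].
have [N] := ubnP k; elim: N k B fB => // N IH k B fB kN.
case: (pselect (is_cp_rank A k)) => [rk|nrk].
  by exists k, B; split=> //; split=> //; apply: rank_fact_indep rk fB.
have [k' [B' [fB' k'k]]] : exists k' (B' : 'M[R]_(n, k')),
    nonneg_fact A B' /\ (k' < k)%N.
  apply: contrapT => none; apply: nrk; split; first by exists B.
  move=> k' B' fB'; rewrite leqNgt; apply/negP => k'k.
  by apply: none; exists k', B'.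
by apply: (IH k' B') => //; apply: leq_trans k'k _.
Qed.

(** Lets uniqueness among minimal factorizations be tested against every nonnegative factorization
    of the same width. *)
Lemma rank_fact_minimal (R : realType) n k (A : 'M[R]_n) (B C : 'M[R]_(n, k)) :
  minimal_cp_fact A B -> nonneg_fact A C -> minimal_cp_fact A C.
Proof.
by move=> [_ rk] fC; split=> //; split=> //; apply: rank_fact_indep rk fC.
Qed.

(** * Supports of columns and edges of the graph *)

Lemma fact_entry_neq0 (R : realType) n k (A : 'M[R]_n) (B : 'M[R]_(n, k)) i j c :
  nonneg_fact A B -> B i c != 0 -> B j c != 0 -> A i j != 0.
Proof.
move=> /nonneg_factP[B0 AE] Bi Bj; rewrite AE gt_eqF // (bigD1 c) //=.
apply: ltr_pwDl; first by rewrite mulr_gt0 // lt_neqAle eq_sym ?Bi ?Bj B0.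
by apply: sumr_ge0 => d _; rewrite mulr_ge0.
Qed.

Lemma fact_entry_col (R : realType) n k (A : 'M[R]_n) (B : 'M[R]_(n, k)) i j :
  nonneg_fact A B -> A i j != 0 -> exists c, B i c != 0 /\ B j c != 0.
Proof.
move=> /nonneg_factP[B0 AE]; case: (pickP (fun c => (B i c != 0) && (B j c != 0))).
  by move=> c /andP[]; exists c.
move=> H; rewrite AE big1 ?eqxx // => c _; apply/eqP; rewrite mulf_eq0.
by have := H c; rewrite -negb_or => /negbFE.
Qed.

Lemma triangle_free_col (R : realType) n k (A : 'M[R]_n) (B : 'M[R]_(n, k)) c i j l :
    triangle_free_graph A -> nonneg_fact A B -> i != j ->
    B i c != 0 -> B j c != 0 -> l != i -> l != j -> B l c = 0.
Proof.
move=> tf fB ij Bi Bj li lj; apply/eqP/negPn/negP => Bl; apply: tf.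
exists i, j, l; rewrite /graph_rel ij [j == l]eq_sym [i == l]eq_sym li lj /=.
by rewrite !(fact_entry_neq0 fB (c := c)).
Qed.

(** Smaller supports are padded to two vertices, so that every column can be treated as lying on a
    pair. *)
Lemma triangle_free_col_pair (R : realType) n k (A : 'M[R]_n) (B : 'M[R]_(n, k)) c :
    (2 <= n)%N -> triangle_free_graph A -> nonneg_fact A B ->
  exists i j, i != j /\ forall l, l != i -> l != j -> B l c = 0.
Proof.
move=> n2 tf fB.
have other (i : 'I_n) : exists j : 'I_n, i != j.
  have n1 := ltnW n2.
  case: (eqVneq i (Ordinal n1)) => [->|ni]; last by exists (Ordinal n1).
  by exists (Ordinal n2).
case: (pickP (fun i => B i c != 0)) => [i Bi|B0]; last first.
  have [j ij] := other (Ordinal n2); exists (Ordinal n2), j; split=> // l _ _.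
  by apply/eqP; have /negbFE := B0 l.
case: (pickP (fun j => (j != i) && (B j c != 0))) => [j /andP[ji Bj]|B0].
  exists i, j; rewrite eq_sym; split=> // l.
  by apply: (triangle_free_col tf fB _ Bi Bj); rewrite eq_sym.
have [j ij] := other i; exists i, j; split=> // l li _.
by apply/eqP; have := B0 l; rewrite li => /negbFE.
Qed.

(** * The form and the kernel of the comparison matrix *)

(** Since [A] is entrywise nonnegative, [M(A)] is twice the diagonal part of [A] minus [A], and both
    split over the columns of [B]. *)
Lemma comparison_mx_form (R : realType) n k (A : 'M[R]_n) (B : 'M[R]_(n, k))
    (x : 'I_n -> R) i :
    nonneg_fact A B ->
  \sum_j comparison_mx A i j * x j =
  \sum_c B i c * (2 * (B i c * x i) - \sum_j B j c * x j).
Proof.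
move=> /nonneg_factP[B0 AE].
have A0 i' j' : 0 <= A i' j'.
  by rewrite AE sumr_ge0 // => c _; rewrite mulr_ge0.
have ME j : comparison_mx A i j = (i == j)%:R * (2 * A i i) - A i j.
  rewrite mxE !ger0_norm //; case: (eqVneq i j) => [->|_].
    by rewrite mul1r mulr_natl mulr2n addrK.
  by rewrite mul0r sub0r.
under eq_bigr => j _ do rewrite ME mulrBl.
rewrite sumrB (bigD1 i) //= big1 => [|j ji]; last first.
  by rewrite eq_sym (negbTE ji) !mul0r.
rewrite eqxx mul1r addr0 AE mulr_sumr mulr_suml.
under [X in _ - X]eq_bigr => j _ do rewrite AE mulr_suml.
rewrite exchange_big /= -sumrB; apply: eq_bigr => c _.
rewrite mulrBr mulr_sumr; congr (_ - _); first by ring.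
by apply: eq_bigr => j _; rewrite mulrA.
Qed.

Lemma comparison_mx_kernel (R : realType) n k (A : 'M[R]_n) (B : 'M[R]_(n, k))
    (x : 'I_n -> R) :
    (2 <= n)%N -> triangle_free_graph A -> nonneg_fact A B ->
    (forall i, \sum_j comparison_mx A i j * x j = 0) ->
  forall c i j, i != j -> (forall l, l != i -> l != j -> B l c = 0) ->
    B i c * x i = B j c * x j.
Proof.
move=> n2 tf fB Mx.
(* The contribution of column [c] to the quadratic form at [x]. On a pair it is [2 * (p ^+ 2 + q ^+
   2) - (p + q) ^+ 2 = (p - q) ^+ 2], so all contributions vanish once their sum does. *)
pose t c := 2 * (\sum_i (B i c * x i) ^+ 2) - (\sum_i B i c * x i) ^+ 2.
have tE c i j : i != j -> (forall l, l != i -> l != j -> B l c = 0) ->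
    t c = (B i c * x i - B j c * x j) ^+ 2.
  move=> ij B0; have S F : (forall l, B l c = 0 -> F l = 0) ->
      \sum_l F l = F i + F j :> R.
    move=> F0; rewrite (bigD1 i) //= (bigD1 j) 1?eq_sym //= big1 ?addr0 //.
    by move=> l /andP[li lj]; apply: F0; apply: B0.
  rewrite /t !S => [|l ->|l ->]; [ring|by rewrite mul0r|].
  by rewrite mul0r expr0n.
have t_ge0 c : 0 <= t c.
  have [i [j [ij B0]]] := triangle_free_col_pair c n2 tf fB.
  by rewrite (tE c i j) // sqr_ge0.
have t0 : \sum_c t c = 0.
  transitivity (\sum_i x i * \sum_j comparison_mx A i j * x j); last first.
    by rewrite big1 // => i _; rewrite Mx mulr0.
  under [RHS]eq_bigr => i _ do rewrite (comparison_mx_form x i fB) mulr_sumr.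
  rewrite exchange_big; apply: eq_bigr => c _ /=; rewrite /t expr2.
  rewrite mulr_sumr mulr_suml -sumrB; apply: eq_bigr => i _.
  by ring.
move=> c i j ij B0; apply/eqP; rewrite -subr_eq0 -sqrf_eq0 -(tE c i j ij B0).
by rewrite (psumr_eq0P (fun c _ => t_ge0 c) t0).
Qed.

Lemma comparison_mx_singularP (R : realType) n (A : 'M[R]_n) :
    symmetric_mx A ->
  \det (comparison_mx A) = 0 <->
  exists x : 'I_n -> R, (exists i, x i != 0) /\
    forall i, \sum_j comparison_mx A i j * x j = 0.
Proof.
move=> sA; have sM i j : comparison_mx A i j = comparison_mx A j i.
  rewrite !mxE eq_sym; case: eqVneq => [->//|_].
  by rewrite -{1}sA mxE.
split=> [/eqP/det0P[v v0 vM]|[x [[i xi] Mx]]].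
  exists (v 0); split; first exact/rV0Pn.
  move=> i; move/matrixP/(_ 0 i): vM; rewrite !mxE => vM.
  by rewrite -[RHS]vM; apply: eq_bigr => j _; rewrite sM mulrC.
apply/eqP/det0P; exists (\row_j x j); first by apply/rV0Pn; exists i; rewrite mxE.
apply/matrixP => u j; rewrite !mxE -[RHS](Mx j).
by apply: eq_bigr => l _; rewrite (sM j) mulrC; congr (_ * _); rewrite mxE.
Qed.

Lemma irreducible_neighbor (R : realType) n (A : 'M[R]_n) i :
  (2 <= n)%N -> irreducible_mx A -> exists j, graph_rel A i j.
Proof.
move=> n2 irr; have [j ij] : exists j : 'I_n, j != i.
  have n1 := ltnW n2.
  case: (eqVneq i (Ordinal n1)) => [->|ni]; last by exists (Ordinal n1); rewrite eq_sym.
  by exists (Ordinal n2).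
case/connectP: (irr i j) => [[|l p]] /=; first by move=> _ E; rewrite E eqxx in ij.
by move=> /andP[il _] _; exists l.
Qed.

(** Being nonzero propagates along an edge: some column covers it, and the kernel balances the two
    entries of that column. *)
Lemma kernel_neq0 (R : realType) n k (A : 'M[R]_n) (B : 'M[R]_(n, k))
    (x : 'I_n -> R) :
    (2 <= n)%N -> triangle_free_graph A -> irreducible_mx A -> nonneg_fact A B ->
    (forall i, \sum_j comparison_mx A i j * x j = 0) -> (exists i, x i != 0) ->
  forall i, x i != 0.
Proof.
move=> n2 tf irr fB Mx [i xi] j; case/connectP: (irr i j) => p.
elim: p i xi => [|l p IH] i xi /=; first by move=> _ ->.
move=> /andP[/andP[il Ail] ep]; apply: IH ep.
have [c [Bi Bl]] := fact_entry_col fB Ail.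
have := comparison_mx_kernel n2 tf fB Mx il
  (fun _ => triangle_free_col tf fB il Bi Bl).
by move=> E; apply: contra_eq_neq E => ->; rewrite mulr0 mulf_neq0.
Qed.

(** * Uniqueness from a singular comparison matrix *)

(** A zero column is dependent on any other column; if there is no other one, [A] would vanish. *)
Lemma cp_fact_col_neq0 (R : realType) n k (A : 'M[R]_n) (B : 'M[R]_(n, k)) :
  (exists i j, A i j != 0) -> cp_fact A B -> forall c, exists v, B v c != 0.
Proof.
move=> [i [j Aij]] [fB indep] c.
case: (pickP (fun v => B v c != 0)) => [v|B0]; first by exists v.
have {}B0 v : B v c = 0 by apply/eqP; have /negbFE := B0 v.
case: (pickP (fun d => c != d)) => [d cd|one].
  have [|/eqP] := indep c d cd 1 0; last by rewrite oner_eq0.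
  by apply/matrixP => v u; rewrite !mxE B0; ring.
move: Aij; have /nonneg_factP[_ ->] := fB; rewrite big1 ?eqxx // => d _.
by have /negbFE/eqP<- := one d; rewrite B0 mul0r.
Qed.

Lemma indep_cols_inj (R : realType) n k (B : 'M[R]_(n, k)) c d :
  pairwise_indep_cols B -> (forall v, B v c = B v d) -> c = d.
Proof.
move=> indep E; apply/eqP/negPn/negP => cd.
have [|/eqP] := indep c d cd 1 (-1); last by rewrite oner_eq0.
by apply/matrixP => v u; rewrite !mxE E; ring.
Qed.

(** Two columns on the same edge have the same ratio of entries, hence would be proportional; so a
    single column accounts for [A i j]. *)
Lemma kernel_entry (R : realType) n k (A : 'M[R]_n) (B : 'M[R]_(n, k))
    (x : 'I_n -> R) :
    (2 <= n)%N -> triangle_free_graph A -> cp_fact A B ->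
    (forall i, \sum_j comparison_mx A i j * x j = 0) -> (forall i, x i != 0) ->
  forall c i j, i != j -> B i c != 0 -> B j c != 0 ->
    B j c = B i c * x i / x j /\ A i j = B i c * B j c.
Proof.
move=> n2 tf [fB indep] Mx x0 c i j ij Bi Bj.
have ratio d : B i d != 0 -> B j d != 0 -> B j d = B i d * x i / x j.
  move=> Bid Bjd; have := comparison_mx_kernel n2 tf fB Mx ij
    (fun _ => triangle_free_col tf fB ij Bid Bjd).
  by move=> ->; rewrite mulfK.
split; first exact: ratio.
have /nonneg_factP[_ ->] := fB; rewrite (bigD1 c) //= big1 ?addr0 // => d dc.
apply/eqP; rewrite mulf_eq0; apply/negPn; rewrite negb_or; apply/negP => /andP[Bid Bjd].
have [|/eqP] := indep d c dc (B i c) (- B i d); last by rewrite (negbTE Bi).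
apply/matrixP => v u; rewrite !mxE.
case: (eqVneq v i) => [->|vi]; first by ring.
case: (eqVneq v j) => [->|vj]; first by rewrite (ratio c) // (ratio d) //; field.
by rewrite !(triangle_free_col tf fB ij _ _ vi vj) //; ring.
Qed.

Lemma kernel_col_mem (R : realType) n k k' (A : 'M[R]_n) (B : 'M[R]_(n, k))
    (C : 'M[R]_(n, k')) (x : 'I_n -> R) :
    (2 <= n)%N -> triangle_free_graph A -> (exists i j, A i j != 0) ->
    cp_fact A B -> cp_fact A C ->
    (forall i, \sum_j comparison_mx A i j * x j = 0) -> (forall i, x i != 0) ->
  forall c, exists d, forall v, C v c = B v d.
Proof.
move=> n2 tf A0 cB cC Mx x0 c.
have [[fB _] [fC _]] := (cB, cC); have [B0 _] := fB; have [C0 _] := fC.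
have [i [j [ij Cz]]] := triangle_free_col_pair c n2 tf fC.
have E := comparison_mx_kernel n2 tf fC Mx ij Cz.
have Ci : C i c != 0.
  have [v] := cp_fact_col_neq0 A0 cC c; apply: contra_neq => Ci.
  case: (eqVneq v i) => [->//|vi]; case: (eqVneq v j) => [->|vj].
    by move/eqP: E; rewrite Ci mul0r eq_sym mulf_eq0 (negbTE (x0 j)) orbF => /eqP.
  exact: Cz.
have Cj : C j c != 0.
  by apply: contra_eq_neq E => ->; rewrite mul0r mulf_neq0.
have [Cr CA] := kernel_entry n2 tf cC Mx x0 ij Ci Cj.
have [d [Bi Bj]] := fact_entry_col fB (fact_entry_neq0 fC Ci Cj).
have [Br BA] := kernel_entry n2 tf cB Mx x0 ij Bi Bj.
(* Ratio [x i / x j] and product [A i j] fix the square of the [i] entry, and the entries are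
   nonnegative. *)
have CB : C i c = B i d.
  apply: (pexpIrn (n := 2)) => //; rewrite ?nnegrE ?C0 ?B0 //.
  have xij : x i / x j != 0 by rewrite mulf_neq0 ?invr_eq0.
  apply: (mulIf xij); rewrite !expr2 -![_ * _ * (_ / _)]mulrA.
  by rewrite ![_ * (x i / _)]mulrA -Cr -Br -CA -BA.
exists d => v; case: (eqVneq v i) => [->//|vi].
case: (eqVneq v j) => [->|vj]; first by rewrite Cr Br CB.
by rewrite Cz // (triangle_free_col tf fB ij Bi Bj).
Qed.

(** Each factorization contains the columns of the other; the two matchings are mutually inverse
    because no column is repeated. *)
Lemma singular_cp_fact_eq (R : realType) n k k' (A : 'M[R]_n) (B : 'M[R]_(n, k))
    (C : 'M[R]_(n, k')) :
    (2 <= n)%N -> symmetric_mx A -> triangle_free_graph A -> irreducible_mx A ->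
    \det (comparison_mx A) = 0 -> cp_fact A B -> cp_fact A C -> cp_fact_eq B C.
Proof.
move=> n2 sA tf irr /(comparison_mx_singularP sA)[x [x0 Mx]] cB cC.
have {}x0 := kernel_neq0 n2 tf irr cB.1 Mx x0.
have A0 : exists i j, A i j != 0.
  have [j /andP[_ Aij]] := irreducible_neighbor (Ordinal n2) n2 irr.
  by exists (Ordinal n2), j.
have /fin_all_exists[e eE] := kernel_col_mem n2 tf A0 cB cC Mx x0.
have /fin_all_exists[g gE] := kernel_col_mem n2 tf A0 cC cB Mx x0.
exists e; split; last by move=> i j; apply: eE.
exists g => c; [apply: (indep_cols_inj cC.2)|apply: (indep_cols_inj cB.2)] => v.
  by rewrite -gE -eE.
by rewrite -eE -gE.
Qed.

Lemma cp_fact_eq_trans (R : realType) n k k1 k2 (B : 'M[R]_(n, k))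
    (C : 'M[R]_(n, k1)) (D : 'M[R]_(n, k2)) :
  cp_fact_eq B C -> cp_fact_eq B D -> cp_fact_eq C D.
Proof.
move=> [e [[e' ek e'k] eE]] [f [[f' fk f'k] fE]].
exists (e' \o f); split; last by move=> i j /=; rewrite eE e'k fE.
by exists (f' \o e) => j /=; rewrite ?e'k ?fk ?f'k ?ek.
Qed.

(** * Deforming a factorization along an unbalanced cycle *)

(* With [u_t], [v_t] the squares of the two entries of column [c t], the new
   squares [u_t + 1 / y_t] and [v_t - 1 / y_(t+1)] keep every row sum (it
   telescopes at each vertex), and they keep the product [u_t * v_t] exactly
   when [v_t * y_(t+1) - u_t * y_t = 1]. *)
Lemma unbalanced_cycle_fact (R : realType) n k (A : 'M[R]_n) (B : 'M[R]_(n, k))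
    (m : nat) (x : nat -> 'I_n) (c : nat -> 'I_k) :
    nonneg_fact A B -> x m = x 0%N ->
    {in [pred t | (t < m)%N] &, injective c} ->
    (forall t, (t < m)%N -> [/\ x t != x t.+1, B (x t) (c t) != 0,
       B (x t.+1) (c t) != 0
       & forall l, l != x t -> l != x t.+1 -> B l (c t) = 0]) ->
    \prod_(0 <= t < m) (B (x t) (c t) ^+ 2 / B (x t.+1) (c t) ^+ 2) != 1 ->
  exists C : 'M[R]_(n, k), [/\ nonneg_fact A C,
    forall i j, (C i j == 0) = (B i j == 0) & C != B].
Proof.
move=> fB xm c_inj cyc unbal; have /nonneg_factP[B0 AE] := fB.
have m_gt0 : (0 < m)%N by case: (posnP m) unbal => // ->; rewrite big_geq ?eqxx.
have sq_gt0 v e : B v e != 0 -> 0 < B v e ^+ 2 by move=> Bve; rewrite exprn_even_gt0.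
case: (cyclic_affine_recurrence _ _ unbal) => [t /cyc[]|t /cyc[]|y [ym yE ysg]].
- by move=> _ /sq_gt0.
- by move=> _ _ /sq_gt0.
have y0 t : (t <= m)%N -> y t != 0.
  by case: ysg => H /H; [move/gt_eqF->|move/lt_eqF->].
have ydiv s t : (s <= m)%N -> (t <= m)%N -> 0 < y s / y t.
  move=> sm tm; case: ysg => H; first by rewrite divr_gt0 ?H.
  by rewrite nmulr_rgt0 ?invr_lt0 ?H.
pose d t := (y t)^-1.
(* The change of the squared entry at [(v, e)], written as a sum over the steps so that row sums
   telescope after exchanging the sums. *)
pose D v e := \sum_(t < m) (((v == x t) && (e == c t))%:R * d t
                          - ((v == x t.+1) && (e == c t))%:R * d t.+1).
have DE t v : (t < m)%N -> D v (c t) =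
    (v == x t)%:R * d t - (v == x t.+1)%:R * d t.+1.
  move=> tm; rewrite /D (bigD1 (Ordinal tm)) //= eqxx !andbT big1 ?addr0 // => s st.
  case: (eqVneq (c t) (c s)) => [cts|_]; last by rewrite !andbF !mul0r subr0.
  by case/eqP: st; apply: val_inj; apply: c_inj; rewrite ?inE /=.
have D0 v e : (forall t, (t < m)%N -> e != c t) -> D v e = 0.
  move=> ec; rewrite /D big1 // => t _.
  by rewrite (negbTE (ec _ (ltn_ord t))) !andbF !mul0r subr0.
have Dsum v : \sum_e D v e = 0.
  rewrite exchange_big /=.
  pose g t := (v == x t)%:R * d t.
  transitivity (\sum_(t < m) - (g t.+1 - g t)).
    apply: eq_bigr => t _; rewrite sumrB opprB.
    rewrite !(bigD1 (c t) (P := predT)) //= eqxx !andbT !big1 ?addr0 // => e.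
      by move/negbTE->; rewrite andbF mul0r.
    by move/negbTE->; rewrite andbF mul0r.
  rewrite sumrN -(big_mkord xpredT (fun t => g t.+1 - g t)) telescope_sumr //.
  by rewrite /g /d xm ym subrr oppr0.
(* By the recurrence the new squares are [v_t * y_(t+1) / y_t] and [u_t * y_t / y_(t+1)]: positive
   since all [y_t] share a sign, and of product [u_t * v_t]. *)
have pos1 t : (t < m)%N -> B (x t) (c t) ^+ 2 + D (x t) (c t) =
    B (x t.+1) (c t) ^+ 2 * (y t.+1 / y t).
  move=> tm; have [xt Bx Bx1 _] := cyc t tm.
  rewrite DE // eqxx (negbTE xt) mul0r subr0 mul1r /d.
  have yt := y0 t (ltnW tm); have yt1 := y0 t.+1 tm.
  apply: (mulIf yt); rewrite -[RHS]mulrA divfK // mulrDl mulVf //.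
  by rewrite -{1}(yE t tm); ring.
have pos2 t : (t < m)%N -> B (x t.+1) (c t) ^+ 2 + D (x t.+1) (c t) =
    B (x t) (c t) ^+ 2 * (y t / y t.+1).
  move=> tm; have [xt Bx Bx1 _] := cyc t tm.
  rewrite DE // eqxx eq_sym (negbTE xt) mul0r sub0r mul1r /d.
  have yt := y0 t (ltnW tm); have yt1 := y0 t.+1 tm.
  apply: (mulIf yt1); rewrite -[RHS]mulrA divfK // mulrDl mulNr mulVf //.
  by rewrite -{1}(yE t tm); ring.
have zero t v : (t < m)%N -> v != x t -> v != x t.+1 ->
    B v (c t) ^+ 2 + D v (c t) = 0.
  move=> tm vx vx1; have [_ _ _ ->//] := cyc t tm.
  by rewrite DE // (negbTE vx) (negbTE vx1) !mul0r subrr expr0n addr0.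
pose C : 'M[R]_(n, k) := \matrix_(v, e) Num.sqrt (B v e ^+ 2 + D v e).
have colP e : (forall v, C v e = B v e /\ D v e = 0) \/
    exists2 t, (t < m)%N & e = c t.
  case: (pickP (fun t : 'I_m => e == c t)) => [t /eqP->|ne]; first by right; exists t.
  left=> v; have De : D v e = 0.
    by apply: D0 => t tm; have /negbT := ne (Ordinal tm).
  by rewrite mxE De addr0 sqrtr_sqr ger0_norm.
have sq_ge0 v e : 0 <= B v e ^+ 2 + D v e.
  case: (colP e) => [H|[t tm ->]]; first by rewrite (H v).2 addr0 sqr_ge0.
  case: (eqVneq v (x t)) => [->|vx].
    by rewrite pos1 // mulr_ge0 ?sqr_ge0 // ltW // ydiv // ltnW.
  case: (eqVneq v (x t.+1)) => [->|vx1]; last by rewrite zero.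
  by rewrite pos2 // mulr_ge0 ?sqr_ge0 // ltW // ydiv // ltnW.
have CB e : forall v, (C v e == 0) = (B v e == 0).
  case: (colP e) => [H v|[t tm -> v]]; first by rewrite (H v).1.
  have [xt Bx Bx1 Bz] := cyc t tm.
  rewrite mxE; case: (eqVneq v (x t)) => [->|vx].
    rewrite pos1 // (negbTE Bx) gt_eqF // sqrtr_gt0.
    by rewrite mulr_gt0 ?sq_gt0 // ydiv // ltnW.
  case: (eqVneq v (x t.+1)) => [->|vx1]; last by rewrite zero // Bz // sqrtr0 !eqxx.
  rewrite pos2 // (negbTE Bx1) gt_eqF // sqrtr_gt0.
  by rewrite mulr_gt0 ?sq_gt0 // ydiv // ltnW.
exists C; split=> //; last first.
  (* The square at [(x 0, c 0)] has changed by [1 / y_0], which is nonzero. *)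
  have [_ Bx _ _] := cyc 0%N m_gt0.
  apply/eqP => /matrixP/(_ (x 0%N) (c 0%N)) /(congr1 (fun z => z ^+ 2)).
  rewrite mxE sqr_sqrtr // => /eqP; rewrite -subr_eq0 addrC addKr DE // eqxx.
  have [/negbTE-> _ _ _] := cyc 0%N m_gt0.
  by rewrite mul0r subr0 mul1r invr_eq0 (negbTE (y0 _ _)).
apply/nonneg_factP; split=> [v e|i j]; first by rewrite mxE sqrtr_ge0.
case: (eqVneq i j) => [<-|ij].
  rewrite AE; transitivity (\sum_e B i e * B i e + \sum_e D i e).
    by rewrite Dsum addr0.
  rewrite -big_split; apply: eq_bigr => e _ /=.
  by rewrite -!expr2 mxE sqr_sqrtr.
rewrite AE; apply: eq_bigr => e _.
case: (colP e) => [H|[t tm ->]]; first by rewrite (H i).1 (H j).1.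
have [xt Bx Bx1 Bz] := cyc t tm.
have prodE : C (x t) (c t) * C (x t.+1) (c t) = B (x t) (c t) * B (x t.+1) (c t).
  rewrite !mxE -sqrtrM // pos1 // pos2 //.
  have yt := y0 t (ltnW tm); have yt1 := y0 t.+1 tm.
  have -> : B (x t.+1) (c t) ^+ 2 * (y t.+1 / y t) *
    (B (x t) (c t) ^+ 2 * (y t / y t.+1)) = (B (x t) (c t) * B (x t.+1) (c t)) ^+ 2.
    by field; rewrite yt yt1.
  by rewrite sqrtr_sqr ger0_norm // mulr_ge0.
have out v : v != x t -> v != x t.+1 -> B v (c t) = 0 /\ C v (c t) = 0.
  by move=> vx vx1; split; first exact: Bz; rewrite mxE zero // sqrtr0.
case: (eqVneq i (x t)) => [ix|ix]; last case: (eqVneq i (x t.+1)) => [ix1|ix1].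
- subst i; case: (eqVneq j (x t.+1)) => [->//|jx1].
  by have [|-> ->] := out j _ jx1; rewrite 1?eq_sym // !mulr0.
- subst i; case: (eqVneq j (x t)) => [->|jx]; first by rewrite mulrC -prodE mulrC.
  by have [|-> ->] := out j jx; rewrite 1?eq_sym // !mulr0.
- by have [-> ->] := out i ix ix1; rewrite !mul0r.
Qed.

(** * A unique factorization has exactly one column per edge *)

(** Its cardinality is invariant under permuting columns, so a rotation that changes it refutes
    uniqueness. *)
Definition mx_support (R : realType) n k (B : 'M[R]_(n, k)) : {set 'I_n * 'I_k} :=
  [set p | B p.1 p.2 != 0].

Lemma cp_fact_eq_support (R : realType) n k (B C : 'M[R]_(n, k)) :
  cp_fact_eq B C -> #|mx_support C| = #|mx_support B|.
Proof.
move=> [e [/bij_inj e_inj eE]].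
have f_inj : injective (fun p : 'I_n * 'I_k => (p.1, e p.2)).
  by move=> [v c] [u d] [-> /e_inj ->].
rewrite -[RHS](card_preimset _ f_inj); congr #|pred_of_set _|.
by apply/setP => p; rewrite !inE /= eE.
Qed.

(** Rotating a column supported on [i] alone with a column on an edge [{i, j}] makes the entry
    [(j, c)] nonzero and kills no entry. *)
Lemma unique_fact_no_singleton (R : realType) n k (A : 'M[R]_n) (B : 'M[R]_(n, k)) :
    (2 <= n)%N -> irreducible_mx A -> nonneg_fact A B ->
    (forall C : 'M[R]_(n, k), nonneg_fact A C -> cp_fact_eq B C) ->
  forall c i, B i c != 0 -> exists j, i != j /\ B j c != 0.
Proof.
move=> n2 irr fB uniqB c i Bi; have [B0 _] := fB.
case: (pickP (fun j => (i != j) && (B j c != 0))) => [j /andP[]|none].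
  by exists j.
have Bc v : v != i -> B v c = 0.
  by move=> vi; apply/eqP; have := none v; rewrite eq_sym vi => /negbFE.
have [j /andP[ij Aij]] := irreducible_neighbor i n2 irr.
have [d [Bid Bjd]] := fact_entry_col fB Aij.
have Bjc : B j c = 0 by rewrite Bc // eq_sym.
have dc : d != c by apply: contra_neq Bjd => ->.
have Bi_gt0 : 0 < B i c by rewrite lt_neqAle eq_sym Bi B0.
have Bid_gt0 : 0 < B i d by rewrite lt_neqAle eq_sym Bid B0.
(* With [a = B i c] the new entry [(i, d)] would vanish; the factor 2 keeps it positive. *)
pose a := 2 * B i c; pose b := B i d.
have a_gt0 : 0 < a by rewrite mulr_gt0.
have ai : a * B i d - b * B i c = B i c * B i d by rewrite /a /b; ring.
have fC : nonneg_fact A (rotate_cols B d c a b).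
  apply: rotate_cols_fact => // [|v|v]; first by rewrite gt_eqF.
    case: (eqVneq v i) => [->|vi]; first by rewrite ai mulr_ge0.
    by rewrite Bc // mulr0 subr0 mulr_ge0 // ltW.
  by rewrite addr_ge0 ?mulr_ge0 // ltW.
have r_neq0 : Num.sqrt (a ^+ 2 + b ^+ 2) != 0.
  by rewrite gt_eqF // sqrtr_gt0 ltr_pwDl ?sqr_ge0 // exprn_gt0.
have := cp_fact_eq_support (uniqB _ fC) => E.
have /proper_card : mx_support B \proper mx_support (rotate_cols B d c a b).
  apply/properP; split; last first.
    exists (j, c); rewrite !inE /= ?Bjc ?eqxx // mxE [c == d]eq_sym (negbTE dc) eqxx.
    by rewrite mulf_neq0 ?invr_eq0 // Bjc mulr0 addr0 mulf_neq0.
  apply/subsetP => [[v f]]; rewrite !inE /= mxE => Bvf.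
  case: (eqVneq f d) => [fd|_]; last case: (eqVneq f c) => [fc|//].
    rewrite mulf_neq0 ?invr_eq0 //; case: (eqVneq v i) => [->|vi].
      by rewrite ai mulf_neq0.
    by rewrite Bc // mulr0 subr0 -fd mulf_neq0 // gt_eqF.
  rewrite mulf_neq0 ?invr_eq0 // gt_eqF // ltr_wpDl //.
    by apply: mulr_ge0; rewrite ?B0 // ltW.
  by rewrite mulr_gt0 // lt_neqAle B0 eq_sym -fc Bvf.
by rewrite E ltnn.
Qed.

(** Rotating by [a = B j d], [b = B j c] annihilates the entry [(j, c)] and creates no nonzero
    entry, so the support shrinks. *)
Lemma unique_fact_edge_col (R : realType) n k (A : 'M[R]_n) (B : 'M[R]_(n, k)) :
    triangle_free_graph A -> cp_fact A B ->
    (forall C : 'M[R]_(n, k), nonneg_fact A C -> cp_fact_eq B C) ->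
  forall c d i j, i != j -> B i c != 0 -> B j c != 0 -> B i d != 0 -> B j d != 0 ->
    c = d.
Proof.
move=> tf [fB indep] uniqB c d i j ij Bic Bjc Bid Bjd; have [B0 _] := fB.
apply/eqP/negPn/negP => cd.
have out v : v != i -> v != j -> B v c = 0 /\ B v d = 0.
  by move=> vi vj; split; apply: (triangle_free_col tf fB ij).
(* Up to normalization this determinant is the new entry [(i, c)]; independence makes it nonzero,
   and exchanging [c] and [d] makes it positive. *)
wlog Dpos : c d Bic Bjc Bid Bjd cd out / 0 < B j d * B i c - B j c * B i d.
  move=> H; case: (ltrgtP (B j d * B i c - B j c * B i d) 0) => [D|D|D].
  - apply: (H d c) => //; rewrite 1?eq_sym //; first by move=> v vi /(out v vi)[].
    by move: D; rewrite -oppr_gt0 opprB.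
  - exact: (H c d).
  - have [|/eqP] := indep c d cd (B j d) (- B j c); last by rewrite (negbTE Bjd).
    apply/matrixP => v u; rewrite !mxE.
    case: (eqVneq v i) => [->|vi]; first by rewrite mulNr.
    case: (eqVneq v j) => [->|vj]; first by ring.
    by have [-> ->] := out v vi vj; ring.
have fC : nonneg_fact A (rotate_cols B c d (B j d) (B j c)).
  apply: rotate_cols_fact => // [|v|v]; first by rewrite Bjd.
    case: (eqVneq v i) => [->|vi]; first exact: ltW.
    case: (eqVneq v j) => [->|vj]; first by rewrite mulrC subrr.
    by have [-> ->] := out v vi vj; rewrite !mulr0 subrr.
  by rewrite addr_ge0 ?mulr_ge0.
have E := cp_fact_eq_support (uniqB _ fC).
have /proper_card : mx_support (rotate_cols B c d (B j d) (B j c)) \proper mx_support B.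
  apply/properP; split; last first.
    exists (j, c); rewrite !inE /= // mxE eqxx negbK.
    by rewrite [B j d * _]mulrC subrr mul0r.
  apply/subsetP => [[v f]]; rewrite !inE /= mxE.
  case: (eqVneq v i) => [->|vi]; last case: (eqVneq v j) => [->|vj].
  - by case: (eqVneq f c) => [->//|_]; case: (eqVneq f d) => [->//|_].
  - by case: (eqVneq f c) => [->//|_]; case: (eqVneq f d) => [->//|_].
  - have [-> ->] := out v vi vj; rewrite !mulr0 subrr addr0 mul0r.
    by do 2?case: ifP => // _; rewrite ?eqxx.
by rewrite E ltnn.
Qed.

(** * From uniqueness to a kernel vector *)

Lemma unique_fact_singular (R : realType) n k (A : 'M[R]_n) (B : 'M[R]_(n, k)) :
    (2 <= n)%N -> symmetric_mx A -> triangle_free_graph A -> irreducible_mx A ->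
    cp_fact A B ->
    (forall C : 'M[R]_(n, k), nonneg_fact A C -> cp_fact_eq B C) ->
  \det (comparison_mx A) = 0.
Proof.
move=> n2 sA tf irr cB uniqB; have [fB indep] := cB; have [B0 _] := fB.
have nosingle := unique_fact_no_singleton n2 irr fB uniqB.
have edge_col := unique_fact_edge_col tf cB uniqB.
pose i0 := Ordinal n2.
have [c0 _] : exists c : 'I_k, True.
  have [j /andP[_ Aij]] := irreducible_neighbor i0 n2 irr.
  by have [c _] := fact_entry_col fB Aij; exists c.
(* [ecol] is chosen on ordered pairs; only [edge_col] makes both orientations of an edge share a
   column. Pairs that are not edges may get the default [c0]. *)
have /fin_all_exists[ecol ecolE] (p : 'I_n * 'I_n) : exists c, graph_rel A p.1 p.2 ->
    B p.1 c != 0 /\ B p.2 c != 0.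
  case: (boolP (graph_rel A p.1 p.2)) => [/andP[_ Ap]|_]; last by exists c0.
  by have [c Bc] := fact_entry_col fB Ap; exists c.
have neq i j : graph_rel A i j -> i != j by case/andP.
have in_col i j l : graph_rel A i j -> B l (ecol (i, j)) != 0 -> l = i \/ l = j.
  move=> eij Bl; have [Bi Bj] := ecolE (i, j) eij.
  case: (eqVneq l i) => [|li]; first by left.
  case: (eqVneq l j) => [|lj]; first by right.
  by rewrite (triangle_free_col tf fB (neq _ _ eij) Bi Bj) ?eqxx in Bl.
pose w i j := B i (ecol (i, j)) / B j (ecol (i, j)).
have w_gt0 i j : graph_rel A i j -> 0 < w i j.
  move=> /(ecolE (i, j))[Bi Bj].
  by rewrite divr_gt0 // lt_neqAle B0 eq_sym ?Bi ?Bj.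
have simple x p : path (graph_rel A) x p -> last x p = x -> uniq p ->
    walk_weight w x p = 1.
  move=> ep lp up; apply/eqP/negPn/negP => unbal.
  (* An edge taken back and forth uses one column twice, with inverse ratios, so its weight is 1. *)
  have m2 : size p != 2%N.
    apply: contra_neq unbal; case: p ep lp {up} => [|y [|z [|]]] //=.
    move=> /and3P[exy eyz _] zx _; subst z.
    have [Bx By] := ecolE (x, y) exy; have [By' Bx'] := ecolE (y, x) eyz.
    rewrite mulr1 /w (edge_col _ _ _ _ (neq _ _ exy) Bx' By' Bx By).
    by rewrite -[_ / _ in X in _ * X]invf_div mulfV // mulf_neq0 ?invr_eq0.
  set m := size p; pose X := nth x (x :: p).
  have XS t : X t.+1 = nth x p t by [].
  have Xe t : (t < m)%N -> graph_rel A (X t) (X t.+1).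
    by move=> tm; have /(pathP x)/(_ t tm) := ep.
  have Xm : X m = X 0%N by rewrite /X -[m]/((size (x :: p)).-1) nth_last.
  (* [uniq p] leaves out the start vertex, which reappears as [X m]; hence the shifted indices. *)
  have Xinj s t : (s < m)%N -> (t < m)%N -> X s.+1 = X t.+1 -> s = t.
    by move=> sm tm /eqP; rewrite !XS nth_uniq // => /eqP.
  pose c t := ecol (X t, X t.+1).
  have cyc t : (t < m)%N -> [/\ X t != X t.+1, B (X t) (c t) != 0,
       B (X t.+1) (c t) != 0
       & forall l, l != X t -> l != X t.+1 -> B l (c t) = 0].
    move=> tm; have [Bi Bj] := ecolE (X t, X t.+1) (Xe t tm).
    have Xn := neq _ _ (Xe t tm); split=> // l.
    exact: (triangle_free_col tf fB Xn).
  (* A shared column would mean the same edge traversed in opposite directions, forcing [t = s + 1]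
     and [X (s + 2) = X s], possible only in a cycle of length 2. *)
  have clt s t : (s < t)%N -> (t < m)%N -> c s != c t.
    move=> st tm; have sm := ltn_trans st tm; apply/eqP => cst.
    have [Xt Bt Bt1 _] := cyc t tm.
    have E1 : X t.+1 = X s.
      have := Bt1; rewrite -cst => /(in_col _ _ _ (Xe s sm))[//|].
      by move/(Xinj _ _ tm sm) => ts; rewrite ts ltnn in st.
    have E0 : X t = X s.+1.
      have := Bt; rewrite -cst => /(in_col _ _ _ (Xe s sm))[|//].
      by move=> E; rewrite E E1 eqxx in Xt.
    case: t st tm cst Xt Bt Bt1 E1 E0 => // t st tm _ _ _ _ E1 E0.
    have ts := Xinj _ _ (ltnW tm) sm E0; subst t.
    case: s {E0} st tm sm E1 => [|s] st tm sm E1.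
      move: Xm; rewrite -E1 -[m in X m](prednK (ltnW tm)) => /Xinj.
      have m_gt0 := ltnW tm; rewrite prednK // => /(_ (leqnn _) tm) m1.
      by case/eqP: m2; rewrite -/m -(prednK m_gt0) m1.
    by have := Xinj _ _ tm (ltnW sm) E1; lia.
  have [||C [fC CB /eqP CneB]] := @unbalanced_cycle_fact _ _ _ A B m X c fB Xm _ cyc.
  - move=> s t sm tm cst; case: (ltngtP s t) => // st.
      by have := clt _ _ st tm; rewrite cst eqxx.
    by have := clt _ _ st sm; rewrite cst eqxx.
  (* The product of squared ratios is the square of the weight, and a positive weight other than 1
     has a square other than 1. *)
  - have -> : \prod_(0 <= t < m) (B (X t) (c t) ^+ 2 / B (X t.+1) (c t) ^+ 2) =
        walk_weight w x p ^+ 2.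
      rewrite (walk_weight_nth _ x) -prodrXl; apply: eq_bigr => t _.
      by rewrite expr_div_n.
    have : 0 < walk_weight w x p.
      rewrite (walk_weight_nth _ x) big_nat_cond prodr_gt0 // => t.
      by rewrite andbT => /= tm; apply: w_gt0; apply: Xe.
    move=> w0; rewrite sqrf_eq1 (negbTE unbal) /=.
    by apply/eqP => w1; move: w0; rewrite w1 ltr0N1.
  have [e [_ eE]] := uniqB C fC; apply: CneB; apply/matrixP => i j.
  have A0 : exists i j, A i j != 0.
    have [l /andP[_ Al]] := irreducible_neighbor i0 n2 irr.
    by exists i0, l.
  have [v Bv] := cp_fact_col_neq0 A0 cB j.
  have [u [vu Bu]] := nosingle j v Bv.
  by rewrite eE (edge_col (e j) j v u) // -eE CB.
have bal := closed_walk_balanced simple.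
have [f [f0 fE]] := balanced_potential i0 irr bal.
apply/(comparison_mx_singularP sA); exists f; split; first by exists i0.
(* A column on [{i, j}] contributes [B i c * (B i c * f i - B j c * f j)], zero by the choice of the
   weights [w]. *)
move=> i; rewrite (comparison_mx_form f i fB) big1 // => c _.
case: (eqVneq (B i c) 0) => [->|Bi]; first by rewrite mul0r.
have [j [ij Bj]] := nosingle c i Bi.
have eij : graph_rel A i j by rewrite /graph_rel ij (fact_entry_neq0 fB Bi Bj).
have [Bi' Bj'] := ecolE (i, j) eij.
rewrite (bigD1 i) //= (bigD1 j) 1?eq_sym //= big1 => [|l /andP[li lj]]; last first.
  by rewrite (triangle_free_col tf fB ij Bi Bj) ?mul0r.
rewrite (fE i j eij) /w -(edge_col _ _ _ _ ij Bi Bj Bi' Bj').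
by field.
Qed.

Theorem theorem4p1 (R : realType) (n : nat) (A : 'M[R]_n) :
  (2 <= n)%N ->
  symmetric_mx A ->
  completely_positive A ->
  irreducible_mx A ->
  triangle_free_graph A ->
  ((\det (comparison_mx A) = 0) <-> unique_cp_fact A) /\
  (unique_cp_fact A <-> unique_minimal_cp_fact A).
Proof.
move=> n2 sA cpA irr tf.
have [k [B mB]] := exists_minimal_cp_fact cpA.
have ab : \det (comparison_mx A) = 0 -> unique_cp_fact A.
  move=> M0; exists k, B; split=> [|k' C cC]; first exact: mB.1.
  exact: singular_cp_fact_eq n2 sA tf irr M0 mB.1 cC.
have bc : unique_cp_fact A -> unique_minimal_cp_fact A.
  (* [F] is not known to be minimal, so the minimal [B] is the witness, and [B] and [C] are compared
     through [F]. *)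
  move=> [k1 [F [_ uF]]]; exists k, B; split=> // k' C [cC _].
  exact: cp_fact_eq_trans (uF _ _ mB.1) (uF _ _ cC).
have ca : unique_minimal_cp_fact A -> \det (comparison_mx A) = 0.
  move=> [k1 [F [mF uF]]]; apply: (unique_fact_singular n2 sA tf irr mF.1) => C fC.
  exact/uF/(rank_fact_minimal mF fC).
by split; split; auto.
Qed.
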